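(* Let $(C_0,C_1)$ be the Garling–Smith interpolation couple (defined in the context), and let $\theta\in(0,1)$ and $p\in[1,+\infty)$. Then there exists an isomorphism $U_\theta:(C_0,C_0+C_1)_{\theta,p}\to(C_1,C_0+C_1)_{\theta,p}$ whose restriction to $C_{\theta,p}=(C_0,C_1)_{\theta,p}$ is an isomorphism $C_{\theta,p}\to C_{1-\theta,p}=(C_0,C_1)_{1-\theta,p}$. Respectively, there exists an isomorphism $U_\theta:(C_0,C_0+C_1)_\theta\to(C_1,C_0+C_1)_\theta$ whose restriction to $C_\theta=(C_0,C_1)_\theta$ is an isomorphism $C_\theta\to C_{1-\theta}=(C_0,C_1)_{1-\theta}$.
   Context: ''Isomorphism'' means a bounded linear bijection between Banach spaces with bounded inverse. Scalars are complex. For an interpolation couple $(A_0,A_1)$ of Banach spaces, $A_{\theta,p}=(A_0,A_1)_{\theta,p}$ is the real (Lions–Peetre) interpolation space and $A_\theta=(A_0,A_1)_\theta$ is Calderón's complex interpolation space, both as in Bergh–Löfström; $A_0+A_1$ has its usual sum norm. The Garling–Smith couple: let $(e_n)_{n\ge1}$ be the canonical unit vectors of $c_0$. The set of elements of $c_0$ of the form $(\pm1,\pm1,\dots,\pm1,0,0,0,\dots)$ (finitely many signs followed by zeros) is countable; let $(r_n)_{n\ge1}$ be an enumeration of it, and put $\varepsilon_n=(1+\|r_n\|_{\ell^1})^{-n}$ for $n\ge1$. Define the following linear subspaces of $c_0\times c_0\times c_0$: $$C_0=\Big\{\Big(\sum_n(a_ne_n+b_nr_n),\ \sum_n\varepsilon_nb_ne_n,\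 \sum_nc_ne_n\Big):\ (a_n)_{n\ge1},(b_n)_{n\ge1},(c_n)_{n\ge1}\in\ell^1\Big\},$$ $$C_1=\Big\{\Big(\sum_n(a_ne_n+c_nr_n),\ \sum_nb_ne_n,\ \sum_n\varepsilon_nc_ne_n\Big):\ (a_n)_{n\ge1},(b_n)_{n\ge1},(c_n)_{n\ge1}\in\ell^1\Big\}.$$ In each case the sequences $(a_n),(b_n),(c_n)$ are uniquely determined by the element, and $C_0$ and $C_1$ are normed by $\|(a_n)\|_{\ell^1}+\|(b_n)\|_{\ell^1}+\|(c_n)\|_{\ell^1}$, so that each is isomorphic to $\ell^1$ and continuously included in $c_0\times c_0\times c_0$. This makes $(C_0,C_1)$ an interpolation couple. *)

(* Defs.v *)
From HB Require Import structures.
From mathcomp Require Import all_boot all_order all_algebra.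
From mathcomp Require Import complex.
From mathcomp Require Import all_classical all_reals all_analysis.
Set Implicit Arguments.
Unset Strict Implicit.
Unset Printing Implicit Defensive.
Import Order.TTheory GRing.Theory Num.Theory numFieldNormedType.Exports.
Local Open Scope classical_set_scope.
Local Open Scope ring_scope.
Local Open Scope complex_scope.

(* The modulus with values in [R]; MathComp's own [`|z|] has values in [R[i]]. *)
Notation cabs := ComplexField.Normc.normc.

(* All the spaces of an interpolation couple, and all the spaces derived from
   it, are linear subspaces of one ambient complex vector space [V], each with
   a norm of its own.  [nrm] is only meaningful on [carrier].  The norm axioms
   are not part of the record, because they are not stable under [nsum] unless
   the two spaces embed continuously in a common Hausdorff space. *)
Record nspace (R : realType) (V : lmodType R[i]) := NSpace {
  carrier :> V -> Prop;
  nrm : V -> R }.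

Section NormedSubspaces.
Variables (R : realType) (V : lmodType R[i]).
Implicit Types E F A B : nspace V.

Definition ncvg E (T : Type) (G : set_system T) (f : T -> V) (l : V) : Prop :=
  (fun x => nrm E (f x - l)) x @[x --> G] --> (0 : R).

Definition has_series_sum E (u : nat -> V) (x : V) : Prop :=
  E x /\ ncvg E \oo (fun N : nat => \sum_(n < N) u n) x.

Definition nsum A B : nspace V := {|
  carrier := [set x | exists a b, [/\ A a, B b & x = a + b]];
  nrm x := inf [set s | exists a b,
             [/\ A a, B b, x = a + b & s = nrm A a + nrm B b]] |}.

(* [bounded_linear E F U]: [U], which is arbitrary off [E], is a bounded linear
   map from [E] to [F]. *)
Definition bounded_linear E F (U : V -> V) : Prop :=
  [/\ set_fun (carrier E) (carrier F) U,
      forall (k : R[i]) x y, E x -> E y -> U (k *: x + y) = k *: U x + U y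
    & exists M : R, forall x, E x -> nrm F (U x) <= M * nrm E x].

Definition isomorphism E F (U : V -> V) : Prop :=
  exists W : V -> V,
    [/\ bounded_linear E F U, bounded_linear F E W,
        forall x, E x -> W (U x) = x & forall y, F y -> U (W y) = y].

End NormedSubspaces.

Section RealMethod.
Variables (R : realType) (V : lmodType R[i]).
Implicit Types A B : nspace V.

Definition Kfun A B (t : R) (x : V) : R :=
  inf [set s | exists a b,
         [/\ A a, B b, x = a + b & s = nrm A a + t * nrm B b]].

Definition real_interp_norm (theta p : R) A B (x : V) : \bar R :=
  ((\int[@lebesgue_measure R]_(t in `]0%R, +oo[)
      ((t `^ (- theta) * Kfun A B t x) `^ p / t)%:E) `^ p^-1)%E.

Definition real_interp (theta p : R) A B : nspace V := {|
  carrier := [set x | nsum A B x /\ (real_interp_norm theta p A B x < +oo)%E];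
  nrm x := fine (real_interp_norm theta p A B x) |}.

End RealMethod.

Section ComplexMethod.
Variables (R : realType) (V : lmodType R[i]).
Implicit Types A B : nspace V.

Definition closed_strip : set R[i]^o :=
  [set z | 0 <= complex.Re z <= 1].
Definition open_strip : set R[i]^o :=
  [set z | 0 < complex.Re z < 1].

(* The condition on the boundary line [Re z = s]: [t |-> f (s + i t)] is a
   continuous function from the real line into [E] vanishing at infinity. *)
Definition boundary_condition (E : nspace V) (s : R) (f : R[i] -> V) : Prop :=
  [/\ forall t : R, E (f (s +i* t)),
      forall t : R, ncvg E (nbhs t) (fun u : R => f (s +i* u)) (f (s +i* t)),
      ncvg E +oo%R (fun t : R => f (s +i* t)) 0
    & ncvg E -oo%R (fun t : R => f (s +i* t)) 0].

(* Calderon's space F(A, B).  Its elements are functions on the closed strip;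
   here they are functions on the plane whose values off the strip are ignored
   everywhere. *)
Definition calderon_space A B (f : R[i] -> V) : Prop :=
  [/\ [/\ forall z, closed_strip z -> nsum A B (f z),
          exists M : R, forall z, closed_strip z -> nrm (nsum A B) (f z) <= M,
          forall z, closed_strip z ->
            ncvg (nsum A B) (within closed_strip (nbhs (z : R[i]^o))) f (f z)
        & forall z, open_strip z -> exists2 l, nsum A B l &
            ncvg (nsum A B) (0 : R[i]^o)^'
              (fun h : R[i] => h^-1 *: (f (z + h) - f z)) l],
      boundary_condition A 0 f
    & boundary_condition B 1 f].

Definition calderon_norm A B (f : R[i] -> V) : R :=
  Num.max (sup (range (fun t : R => nrm A (f (0 +i* t)))))
          (sup (range (fun t : R => nrm B (f (1 +i* t))))).

Definition complex_interp (theta : R) A B : nspace V := {|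
  carrier := [set x | exists2 f, calderon_space A B f & f theta%:C = x];
  nrm x := inf [set s | exists f,
             [/\ calderon_space A B f, f theta%:C = x
               & s = calderon_norm A B f]] |}.

End ComplexMethod.

Section GarlingSmith.
Variable R : realType.

Definition cseq : lmodType R[i] := (nat -> R[i])%type.

Definition ell1 : nspace cseq := {|
  carrier := [set a : nat -> R[i] | cvgn (series (fun n => cabs (a n)))];
  nrm a := limn (series (fun n => cabs (a n))) |}.

Definition c0 : nspace cseq := {|
  carrier := [set x : nat -> R[i] | (fun n => cabs (x n)) @ \oo --> (0 : R)];
  nrm x := sup (range (fun n => cabs (x n))) |}.

(* Sequences are indexed from 0, so that index [n] here stands for [n + 1] in
   the usual indexing of the Garling-Smith couple by positive integers. *)
Definition e_ (n : nat) : cseq := fun k => (k == n)%:R.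

Definition finite_sign_seq : set cseq :=
  [set x : nat -> R[i] | exists2 N : nat, (0 < N)%N &
     (forall k, (k < N)%N -> x k = 1 \/ x k = -1) /\
     (forall k, (N <= k)%N -> x k = 0)].

Definition is_enumeration (r : nat -> cseq) : Prop :=
  set_bij [set: nat] finite_sign_seq r.

Definition eps_ (r : nat -> cseq) (n : nat) : R :=
  (1 + nrm ell1 (r n)) ^- n.+1.

Definition gsV : lmodType R[i] := (cseq * cseq * cseq)%type.

(* [GS0_coefs r a b c x]: [x] is the element of C_0 with coefficients [a], [b]
   and [c]; the series converge in c_0. *)
Definition GS0_coefs (r : nat -> cseq) (a b c : nat -> R[i]) (x : gsV) : Prop :=
  [/\ ell1 a, ell1 b & ell1 c] /\
  [/\ has_series_sum c0 (fun n => a n *: e_ n + b n *: r n) x.1.1,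
      has_series_sum c0 (fun n => ((eps_ r n)%:C * b n) *: e_ n) x.1.2
    & has_series_sum c0 (fun n => c n *: e_ n) x.2].

Definition GS1_coefs (r : nat -> cseq) (a b c : nat -> R[i]) (x : gsV) : Prop :=
  [/\ ell1 a, ell1 b & ell1 c] /\
  [/\ has_series_sum c0 (fun n => a n *: e_ n + c n *: r n) x.1.1,
      has_series_sum c0 (fun n => b n *: e_ n) x.1.2
    & has_series_sum c0 (fun n => ((eps_ r n)%:C * c n) *: e_ n) x.2].

(* The coefficients of an element are unique, so [get] picks the only element
   of a singleton. *)
Definition GS0 (r : nat -> cseq) : nspace gsV := {|
  carrier := [set x | exists a b c, GS0_coefs r a b c x];
  nrm x := get [set s : R | exists a b c, GS0_coefs r a b c x /\
             s = nrm ell1 a + nrm ell1 b + nrm ell1 c] |}.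

Definition GS1 (r : nat -> cseq) : nspace gsV := {|
  carrier := [set x | exists a b c, GS1_coefs r a b c x];
  nrm x := get [set s : R | exists a b c, GS1_coefs r a b c x /\
             s = nrm ell1 a + nrm ell1 b + nrm ell1 c] |}.

End GarlingSmith.

(* Main.v *)
Require Import Defs.
From HB Require Import structures.
From mathcomp Require Import all_boot all_order all_algebra.
From mathcomp Require Import complex.
From mathcomp Require Import all_classical all_reals all_analysis.
From mathcomp Require Import measurable_realfun.
Set Implicit Arguments.
Unset Strict Implicit.
Unset Printing Implicit Defensive.
Import Order.TTheory GRing.Theory Num.Theory numFieldNormedType.Exports.
Local Open Scope classical_set_scope.
Local Open Scope ring_scope.

(** The Garling-Smith couple is symmetric: exchanging the last two coordinates
    of c_0 x c_0 x c_0 exchanges the two spaces of the couple, isometrically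
    ([GS1E]: it turns coefficients (a, b, c) into (a, c, b)).  This exchange
    [swap] is the isomorphism for both interpolation methods.

    Interpolation is functorial, and functoriality along a linear involution T
    can be stated as an equality: if [pullback T E] is E transported along T,
    then sums, real and complex interpolation spaces of transported spaces are
    the transported ones ([nsum_pullback], [real_interp_pullback],
    [complex_interp_pullback]).  As the sum C_0 + C_1 is its own transport,
    [swap] maps (C_0, C_0 + C_1)_theta onto (C_1, C_0 + C_1)_theta, and
    (C_0, C_1)_theta onto (C_1, C_0)_theta.

    The latter space is (C_0, C_1)_(1 - theta), by the two classical symmetries.
    For the real method ([real_interpC]) this is K(t; B, A) = t K(1/t; A, B)
    followed by the substitution t -> 1/t, under which dt/t is invariant; the
    substitution is licit because K is continuous in t.  For the complex method
    ([complex_interp_reflect]) one reflects the strip by z -> 1 - z.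

    Finally (A, B)_theta is contained in (A, A + B)_theta because B is contained
    in A + B with smaller norm ([real_interp_absorb], [complex_interp_absorb]).
    This uses that A has norm 0 at 0, which for C_0 amounts to the uniqueness of
    the coefficients of 0 ([GS0_coefs0]). *)

(** * Sums and the K-functional *)

Section Subspaces.
Variables (R : realType) (V : lmodType R[i]).
Implicit Types E F A B : nspace V.

Lemma nspace_eq E F :
  (forall x, E x <-> F x) -> (forall x, nrm E x = nrm F x) -> E = F.
Proof.
case: E F => [E nE] [F nF] /= EF nEF.
have -> : E = F by apply/funext => x; exact/propext.
by have -> : nE = nF by exact/funext.
Qed.

Definition lin_closed E :=
  E 0 /\ forall (k : R[i]) x y, E x -> E y -> E (k *: x + y).

(** Asked at every vector, also off the carrier: all the norms below are infima,
    suprema, limits or choices of nonnegative reals with default value 0, so they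
    satisfy it. *)
Definition norm_ge0 E := forall x, 0 <= nrm E x.

Lemma lin_closedD E x y : lin_closed E -> E x -> E y -> E (x + y).
Proof. by move=> [_ lE] Ex Ey; rewrite -[x]scale1r; exact: lE. Qed.

Lemma lin_closedB E x y : lin_closed E -> E x -> E y -> E (x - y).
Proof. by move=> [_ lE] Ex Ey; rewrite addrC -scaleN1r; exact: lE. Qed.

Lemma Kfun_le A B t a b : norm_ge0 A -> norm_ge0 B -> 0 <= t -> A a -> B b ->
  Kfun A B t (a + b) <= nrm A a + t * nrm B b.
Proof.
move=> A0 B0 t0 Aa Bb; apply: ge_inf; last by exists a, b.
by exists 0 => _ [a' [b' [_ _ _ ->]]]; rewrite addr_ge0 ?mulr_ge0.
Qed.

Lemma le_Kfun A B t x m : nsum A B x ->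
  (forall a b, A a -> B b -> x = a + b -> m <= nrm A a + t * nrm B b) ->
  m <= Kfun A B t x.
Proof.
move=> [a [b [Aa Bb xab]]] mle; apply: lb_le_inf.
  by exists (nrm A a + t * nrm B b), a, b.
by move=> _ [a' [b' [Aa' Bb' xab' ->]]]; exact: mle.
Qed.

Lemma Kfun_eq0_out A B t x : ~ nsum A B x -> Kfun A B t x = 0.
Proof.
move=> nx; rewrite /Kfun [X in inf X](_ : _ = set0) ?inf0//.
apply/seteqP; split=> // s [a [b [Aa Bb xab _]]].
by apply: nx; exists a, b.
Qed.

Lemma Kfun_ge0 A B t x : norm_ge0 A -> norm_ge0 B -> 0 <= t ->
  0 <= Kfun A B t x.
Proof.
move=> A0 B0 t0; have [xAB|xAB] := pselect (nsum A B x).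
  by apply: le_Kfun => // a b _ _ _; rewrite addr_ge0 ?mulr_ge0.
by rewrite Kfun_eq0_out.
Qed.

(** Every comparison of two K-functionals amounts to a comparison of the costs of
    decompositions; off the sum space both sides are the infimum of the empty
    set, that is 0. *)
Lemma le_Kfun_scale A B A' B' t t' c x : norm_ge0 A -> norm_ge0 B ->
  0 <= t -> 0 < c -> (nsum A B x <-> nsum A' B' x) ->
  (forall a b, A' a -> B' b -> x = a + b ->
     exists a' b', [/\ A a', B b', x = a' + b' &
       nrm A a' + t * nrm B b' <= c * (nrm A' a + t' * nrm B' b)]) ->
  Kfun A B t x <= c * Kfun A' B' t' x.
Proof.
move=> A0 B0 t0 c0 AB' le; have [xAB|xAB] := pselect (nsum A B x); last first.
  by rewrite !Kfun_eq0_out ?mulr0//; move/AB'.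
rewrite -ler_pdivrMl//; apply: le_Kfun; first exact/AB'.
move=> a b Aa Bb /(le a b Aa Bb)[a' [b' [Aa' Bb' xab']]].
rewrite ler_pdivrMl//; apply: le_trans.
by rewrite xab'; exact: Kfun_le.
Qed.

Lemma Kfun_homo A B s t x : norm_ge0 A -> norm_ge0 B -> 0 <= s -> s <= t ->
  Kfun A B s x <= Kfun A B t x.
Proof.
move=> A0 B0 s0 st; rewrite -[leRHS]mul1r; apply: le_Kfun_scale => //.
move=> a b Aa Bb ->; exists a, b; split => //.
by rewrite mul1r lerD2l ler_wpM2r.
Qed.

(** K(t) / t is nonincreasing in t.  With [Kfun_homo] this controls K from both
    sides near any t > 0. *)
Lemma Kfun_div_homo A B s t x : norm_ge0 A -> norm_ge0 B -> 0 < s -> s <= t ->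
  Kfun A B t x <= t / s * Kfun A B s x.
Proof.
move=> A0 B0 s0 st; have t0 : 0 < t := lt_le_trans s0 st.
apply: le_Kfun_scale => //; [exact: ltW|exact: divr_gt0|].
move=> a b Aa Bb ->; exists a, b; split => //.
rewrite mulrDr mulrA divfK ?gt_eqF// lerD2r ler_peMl//.
by rewrite ler_pdivlMr// mul1r.
Qed.

Lemma nsumC A B : nsum A B = nsum B A.
Proof.
apply: nspace_eq => [x|x].
  by split=> -[a [b [? ? ->]]]; exists b, a; rewrite addrC.
congr inf; apply/seteqP.
by split=> s -[a [b [? ? -> ->]]]; exists b, a; rewrite addrC (addrC (nrm _ _)).
Qed.

(** A decomposition of cost n_B + t n_A has the cost t (n_A + t^-1 n_B). *)
Lemma Kfun_sym A B t x : norm_ge0 A -> norm_ge0 B -> 0 < t ->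
  Kfun B A t x = t * Kfun A B t^-1 x.
Proof.
move=> A0 B0 t0.
(* One inequality suffices: the converse one is the same at the inverse of t,
   with the two spaces exchanged. *)
have sub A' B' u : norm_ge0 A' -> norm_ge0 B' -> 0 < u ->
    Kfun B' A' u x <= u * Kfun A' B' u^-1 x.
  move=> A'0 B'0 u0; apply: le_Kfun_scale => //; first exact: ltW.
    by rewrite nsumC.
  move=> a b Aa Bb ->; exists b, a; split; rewrite // 1?addrC//.
  by rewrite mulrDr mulVKf ?gt_eqF// addrC.
apply/eqP; rewrite eq_le sub//=.
rewrite -ler_pdivlMl//; apply: le_trans (sub _ _ _ B0 A0 _) _.
  by rewrite invr_gt0.
by rewrite invrK.
Qed.

(** The sum norm is K(1), so what is known of K applies to it. *)
Lemma nrm_nsumE A B x : nrm (nsum A B) x = Kfun A B 1 x.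
Proof.
congr inf; apply/seteqP.
by split=> s [a [b [? ? -> ->]]]; exists a, b; rewrite mul1r.
Qed.

Lemma nsum_norm_ge0 A B : norm_ge0 A -> norm_ge0 B -> norm_ge0 (nsum A B).
Proof. by move=> A0 B0 x; rewrite nrm_nsumE Kfun_ge0. Qed.

Lemma nsumr A B x : A 0 -> B x -> nsum A B x.
Proof. by move=> A0 Bx; exists 0, x; rewrite add0r. Qed.

(** From the decomposition x = 0 + x. *)
Lemma nrm_nsum_ler A B x : norm_ge0 A -> norm_ge0 B -> A 0 -> nrm A 0 = 0 ->
  B x -> nrm (nsum A B) x <= nrm B x.
Proof.
move=> A0 B0 A00 nA0 Bx; rewrite nrm_nsumE -[in leLHS](add0r x).
by apply: le_trans (Kfun_le _ _ _ _ _) _; rewrite // nA0 add0r mul1r.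
Qed.

Lemma eq_real_interp_norm theta p A B A' B' x x' :
  (forall t, 0 < t -> Kfun A B t x = Kfun A' B' t x') ->
  real_interp_norm theta p A B x = real_interp_norm theta p A' B' x'.
Proof.
move=> KK; rewrite /real_interp_norm.
apply: (congr1 (fun z => (z `^ p^-1)%E)); apply: eq_integral => t.
by rewrite inE /= in_itv /= andbT => /KK ->.
Qed.

(** * Replacing the second space of a couple by the sum *)

Section Absorption.
Variables A B : nspace V.
Hypotheses (A0 : norm_ge0 A) (B0 : norm_ge0 B).
Hypotheses (lA : lin_closed A) (lB : lin_closed B) (nA0 : nrm A 0 = 0).

Lemma nsum_absorb x : nsum A (nsum A B) x <-> nsum A B x.
Proof.
split=> [[a [_ [Aa [a' [b [Aa' Bb ->]]] ->]]]|xAB].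
  by exists (a + a'), b; rewrite addrA; split => //; exact: lin_closedD.
by apply: nsumr => //; case: lA.
Qed.

(** Holds at every vector: off the sum space both norms take the default value 0. *)
Lemma nrm_nsum_absorb x : nrm (nsum A (nsum A B)) x <= nrm (nsum A B) x.
Proof.
have [xAB|xAB] := pselect (nsum A B x).
  by apply: nrm_nsum_ler => //; [exact: nsum_norm_ge0|case: lA].
by rewrite !nrm_nsumE !Kfun_eq0_out// nsum_absorb.
Qed.

Lemma Kfun_absorb t x : 0 <= t -> nsum A B x ->
  Kfun A (nsum A B) t x <= Kfun A B t x.
Proof.
move=> t0 xAB; apply: le_Kfun => // a b Aa Bb ->.
have A00 : A 0 by case: lA.
apply: le_trans (Kfun_le _ _ _ _ _) _ => //; first exact: nsum_norm_ge0.
  exact: nsumr.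
by rewrite lerD2l ler_wpM2l// nrm_nsum_ler.
Qed.

Lemma ncvg_le E F T (G : set_system T) (f : T -> V) l : Filter G ->
  norm_ge0 F ->
  (\forall x \near G, nrm F (f x - l) <= nrm E (f x - l)) ->
  ncvg E G f l -> ncvg F G f l.
Proof.
move=> FG F0 FE; apply: (@squeeze_cvgr _ _ _ _ (cst 0)); last exact: cvg_cst.
by apply: filterS FE => x ->; rewrite F0.
Qed.

Lemma calderon_space_absorb f :
  calderon_space A B f -> calderon_space A (nsum A B) f.
Proof.
have A00 : A 0 by case: lA.
have S0 := nsum_norm_ge0 A0 B0; have SS0 := nsum_norm_ge0 A0 S0.
have absorb T (G : set_system T) (h : T -> V) l : Filter G ->
    ncvg (nsum A B) G h l -> ncvg (nsum A (nsum A B)) G h l.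
  by move=> FG; apply: ncvg_le => //; apply: filterE => x;
     exact: nrm_nsum_absorb.
have BS T (G : set_system T) (h : T -> V) l : Filter G ->
    (forall x, B (h x)) -> B l -> ncvg B G h l -> ncvg (nsum A B) G h l.
  move=> FG Bh Bl; apply: ncvg_le => //; apply: filterE => x.
  by apply: nrm_nsum_ler => //; exact: lin_closedB.
move=> [[fS [M fM] fc fd] fA [fB cB pB mB]]; split=> //; split.
- by move=> z /fS; rewrite nsum_absorb.
- exists M => z /fM; apply: le_trans; exact: nrm_nsum_absorb.
- by move=> z /fc; exact: absorb.
- move=> z /fd[l Sl dl]; exists l; first by rewrite nsum_absorb.
  exact: absorb.
- by move=> t; exact: nsumr.
- by move=> t; apply: BS.
- by apply: BS => //; case: lB.
- by apply: BS => //; case: lB.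
Qed.

Lemma complex_interp_absorb theta :
  carrier (complex_interp theta A B) `<=`
  carrier (complex_interp theta A (nsum A B)).
Proof. by move=> x [f /calderon_space_absorb]; exists f. Qed.

End Absorption.

(** * Transport along a linear involution *)

Section Pullback.
Variable T : {linear V -> V}.
Hypothesis TT : involutive T.

Definition pullback E : nspace V :=
  {| carrier := [set x | E (T x)]; nrm x := nrm E (T x) |}.

Lemma pullbackK E : pullback (pullback E) = E.
Proof. by apply: nspace_eq => x; rewrite /= TT. Qed.

Lemma pullback_norm_ge0 E : norm_ge0 E -> norm_ge0 (pullback E).
Proof. by move=> E0 x; exact: E0. Qed.

Lemma pullback_lin_closed E : lin_closed E -> lin_closed (pullback E).
Proof.
move=> [E0 lE]; split=> [|k x y]; first by rewrite /= linear0.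
by rewrite /= linearP; exact: lE.
Qed.

Lemma Kfun_pullback A B t x :
  Kfun (pullback A) (pullback B) t x = Kfun A B t (T x).
Proof.
congr inf; apply/seteqP; split=> s /= [a [b [Aa Bb xab ->]]].
  by exists (T a), (T b); rewrite xab linearD.
by exists (T a), (T b); rewrite !TT -linearD -xab TT.
Qed.

Lemma nsum_pullback A B :
  nsum (pullback A) (pullback B) = pullback (nsum A B).
Proof.
apply: nspace_eq => x; last first.
  by rewrite nrm_nsumE Kfun_pullback; exact/esym/nrm_nsumE.
split=> /= -[a [b [Aa Bb xab]]].
  by exists (T a), (T b); rewrite xab linearD.
by exists (T a), (T b); rewrite !TT -linearD -xab TT.
Qed.

(** T is an isometry from E onto its transport, and is its own inverse. *)
Lemma isomorphism_pullback E : isomorphism E (pullback E) T.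
Proof.
exists T; split; [split|split|move=> x _; exact: TT|move=> x _; exact: TT].
- by move=> x Ex; rewrite /= TT.
- by move=> k x y _ _; rewrite linearP.
- by exists 1 => x _; rewrite /= TT mul1r.
- by move=> x.
- by move=> k x y _ _; rewrite linearP.
- by exists 1 => x _; rewrite /= mul1r.
Qed.

Lemma real_interp_pullback theta p A B :
  real_interp theta p (pullback A) (pullback B) =
  pullback (real_interp theta p A B).
Proof.
have nE x : real_interp_norm theta p (pullback A) (pullback B) x =
            real_interp_norm theta p A B (T x).
  by apply: eq_real_interp_norm => t _; rewrite Kfun_pullback.
apply: nspace_eq => x; last by rewrite /= nE.
change (real_interp theta p (pullback A) (pullback B) x <->
  nsum A B (T x) /\ (real_interp_norm theta p A B (T x) < +oo)%E).
have -> : nsum A B (T x) = nsum (pullback A) (pullback B) x.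
  by rewrite nsum_pullback.
by rewrite -nE.
Qed.

Lemma ncvg_pullback E S (G : set_system S) f l :
  ncvg (pullback E) G f l = ncvg E G (T \o f) (T l).
Proof. by rewrite /ncvg /=; under eq_fun do rewrite linearB. Qed.

Lemma calderon_space_pullback A B f :
  calderon_space (pullback A) (pullback B) f = calderon_space A B (T \o f).
Proof.
have bE E s : boundary_condition (pullback E) s f =
              boundary_condition E s (T \o f).
  rewrite /boundary_condition !ncvg_pullback linear0.
  apply/propext; split=> -[Ef cf ? ?]; split=> // t.
    by have := cf t; rewrite ncvg_pullback.
  by rewrite ncvg_pullback; exact: cf.
apply/propext; rewrite /calderon_space !bE nsum_pullback.
split=> -[[fS fM fc fd] fA fB]; split=> //; split=> //.
- by move=> z /fc; rewrite ncvg_pullback.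
- move=> z /fd[l Sl]; rewrite ncvg_pullback => dl; exists (T l) => //.
  by move: dl; rewrite /ncvg /comp; under eq_fun do rewrite linearZ linearB.
- by move=> z /fc; rewrite ncvg_pullback.
- move=> z /fd[l Sl] dl; exists (T l); rewrite ?ncvg_pullback/= TT//.
  move: dl; rewrite /ncvg /comp.
  by under [in X in _ -> X]eq_fun do rewrite linearZ linearB.
Qed.

Lemma complex_interp_pullback theta A B :
  complex_interp theta (pullback A) (pullback B) =
  pullback (complex_interp theta A B).
Proof.
have TTf (f : R[i] -> V) : T \o (T \o f) = f by apply/funext=> z /=; rewrite TT.
apply: nspace_eq => x /=.
  split=> -[f].
    by rewrite calderon_space_pullback => cf <-; exists (T \o f).
  by move=> cf fx; exists (T \o f); rewrite ?calderon_space_pullback ?TTf//= fx TT.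
congr inf; apply/seteqP; split=> s [f []].
  by rewrite calderon_space_pullback => cf <- ->; exists (T \o f).
move=> cf fx ->; exists (T \o f).
rewrite calderon_space_pullback TTf /= fx TT; split=> //.
by rewrite -[calderon_norm (pullback _) _ _]/(calderon_norm A B (T \o (T \o f))) TTf.
Qed.

End Pullback.

(** * Exchanging the spaces in the complex method *)

Section Reflection.

(** The carrier and the norm are invariant under x -> - x.  Reflecting the strip
    changes the sign of derivatives, so the norm of the sum has to be even. *)
Definition symmetric_norm E := pullback -%R E = E.

(** The point reflection about 1/2, which is holomorphic and exchanges the two
    boundary lines of the strip. *)
Definition strip_flip (z : R[i]) : R[i] := 1 - z.

Lemma strip_flipK : involutive strip_flip.
Proof. by move=> z; rewrite /strip_flip subKr. Qed.

Lemma strip_flip_line (s t : R) : strip_flip ((1 - s) +i* t)%C = (s +i* - t)%C.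
Proof. by apply/eqP; rewrite eq_complex /= subKr sub0r !eqxx. Qed.

Lemma ncvg_comp E S S' (F : set_system S) (G : set_system S') c f l :
  c x @[x --> F] --> G -> ncvg E G f l -> ncvg E F (f \o c) l.
Proof. by move=> cFG; exact: (cvg_comp _ _ cFG). Qed.

Lemma continuous_strip_flip : continuous (strip_flip : R[i]^o -> R[i]^o).
Proof.
move=> z; apply: (@continuousB R[i] R[i]^o R[i]^o (cst 1) id).
  exact: cst_continuous.
exact: cvg_id.
Qed.

Lemma closed_strip_reflect z : closed_strip z -> closed_strip (strip_flip z).
Proof.
by case: z => a b; rewrite /closed_strip /= => /andP[? ?]; rewrite subr_ge0 gerBl; apply/andP.
Qed.

Lemma open_strip_reflect z : open_strip z -> open_strip (strip_flip z).
Proof.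
by case: z => a b; rewrite /open_strip /= => /andP[? ?]; rewrite subr_gt0 gtrBl; apply/andP.
Qed.

Lemma boundary_condition_reflect E s f :
  boundary_condition E s f -> boundary_condition E (1 - s) (f \o strip_flip).
Proof.
have fE : (fun t : R => (f \o strip_flip) ((1 - s) +i* t)%C) =
          (fun t : R => f (s +i* t)%C) \o -%R.
  by apply/funext => t; rewrite /= strip_flip_line.
move=> [Ef cf pf mf]; split.
- by move=> t; rewrite /= strip_flip_line.
- move=> t; rewrite fE /= strip_flip_line; apply: ncvg_comp; last exact: cf.
  exact: continuousN.
- by rewrite fE; apply: ncvg_comp mf; rewrite -ninfty.
- by rewrite fE; apply: ncvg_comp pf; rewrite -ninftyN.
Qed.

(** At z, the derivative of f (1 - z) is minus that of f at 1 - z: the difference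
    quotient at h is minus the difference quotient of f at - h. *)
Lemma calderon_space_reflect A B f : symmetric_norm A -> symmetric_norm B ->
  calderon_space B A f -> calderon_space A B (f \o strip_flip).
Proof.
move=> sA sB [[fS [M fM] fc fd] fB fA]; split; last 2 first.
- by rewrite -(subrr 1); exact: boundary_condition_reflect.
- by rewrite -(subr0 1); exact: boundary_condition_reflect.
have sS : symmetric_norm (nsum A B).
  by rewrite /symmetric_norm -nsum_pullback ?sA ?sB//; exact: opprK.
have nSN x : nrm (nsum A B) (- x) = nrm (nsum A B) x.
  by rewrite -[in RHS]sS.
rewrite (nsumC B) in fS fM fc fd.
split.
- by move=> z /closed_strip_reflect /fS.
- by exists M => z /closed_strip_reflect /fM.
- move=> z cz; apply: ncvg_comp (fc _ (closed_strip_reflect cz)) => P /= PP.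
  have := @continuous_strip_flip z _ PP.
  change (nbhs z (fun t => closed_strip (strip_flip t) -> P (strip_flip t)) ->
    nbhs z (fun t => closed_strip t -> P (strip_flip t))).
  apply: filterS => x Px cx.
  exact/Px/closed_strip_reflect.
move=> z oz; have [l Sl dl] := fd _ (open_strip_reflect oz).
exists (- l); first by rewrite -sS /= opprK.
have oppd : (- h : R[i]^o) @[h --> (0 : R[i]^o)^'] --> (0 : R[i]^o)^'.
  move=> P PP; have : (- h : R[i]^o) @[h --> (0 : R[i]^o)] --> (- 0 : R[i]^o).
    exact: (@opp_continuous R[i]^o 0).
  rewrite oppr0 => /(_ _ PP).
  change (nbhs (0 : R[i]^o) (fun h => - h != 0 -> P (- h)) ->
    nbhs (0 : R[i]^o) (fun h => h != 0 -> P (- h))).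
  apply: filterS => h Ph h0.
  by apply: Ph; rewrite oppr_eq0.
apply: cvg_trans (ncvg_comp oppd dl); apply: near_eq_cvg.
apply: filterE => h; rewrite /comp.
rewrite -[in RHS]nSN; congr nrm.
by rewrite opprD opprK invrN scaleNr /strip_flip opprD addrA.
Qed.

Lemma calderon_norm_reflect A B f :
  calderon_norm A B (f \o strip_flip) = calderon_norm B A f.
Proof.
have rE E s : range (fun t : R => nrm E ((f \o strip_flip) ((1 - s) +i* t)%C)) =
              range (fun t : R => nrm E (f (s +i* t)%C)).
  apply/seteqP; split=> _ [t _ <-] /=; exists (- t) => //.
    by rewrite strip_flip_line.
  by rewrite strip_flip_line opprK.
have := rE A 1; have := rE B 0; rewrite subrr subr0 => B0 A1.
by rewrite /calderon_norm A1 B0 maxC.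
Qed.

Lemma complex_interp_reflect theta A B :
  symmetric_norm A -> symmetric_norm B ->
  complex_interp (1 - theta) A B = complex_interp theta B A.
Proof.
move=> sA sB.
have rt : strip_flip (1 - theta)%:C%C = theta%:C%C.
  by rewrite strip_flip_line oppr0.
have rt' : strip_flip theta%:C%C = (1 - theta)%:C%C by rewrite -rt strip_flipK.
apply: nspace_eq => x /=.
  split=> -[f cf <-]; exists (f \o strip_flip); rewrite /= ?rt ?rt'//;
    exact: calderon_space_reflect.
congr inf; apply/seteqP; split=> s [f [cf <- ->]]; exists (f \o strip_flip);
  split; rewrite /= ?rt ?rt' ?calderon_norm_reflect//;
  exact: calderon_space_reflect.
Qed.

End Reflection.

End Subspaces.

(** * The substitution of 1/t for t on the positive half-line *)

Section InversionSubstitution.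
Variable R : realType.
Notation mu := (@lebesgue_measure R).

Lemma derive1_inv (x : R) : x != 0 -> (GRing.inv : R -> R)^`()%classic x = - x ^- 2.
Proof.
move=> x0; rewrite derive1E deriveV// derive_id.
by rewrite scaler1.
Qed.

Lemma continuous_inv2 (x : R) : x != 0 ->
  {for x, continuous (fun y : R => - y ^- 2)}.
Proof.
move=> x0; apply: continuousN; apply: continuousV; first by rewrite expf_neq0.
exact: exprn_continuous.
Qed.

Lemma continuous_derive1_inv (x : R) : 0 < x ->
  {for x, continuous (GRing.inv : R -> R)^`()%classic}.
Proof.
move=> x0; rewrite /prop_for /continuous_at derive1_inv ?gt_eqF//.
apply: cvg_trans (continuous_inv2 (lt0r_neq0 x0)).
apply: near_eq_cvg; near=> y; rewrite derive1_inv// gt_eqF//.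
near: y; exact: lt_nbhsr.
Unshelve. all: by end_near. Qed.

Lemma integral_inv_itv (G : R -> R) (a b : R) : 0 < a -> a <= b ->
  (forall t, 0 < t -> {for t, continuous G}) ->
  (\int[mu]_(t in `[b^-1%R, a^-1%R]) (G t)%:E =
   \int[mu]_(t in `[a, b]) (G t^-1 / t ^+ 2)%:E)%E.
Proof.
move=> a0 ab cG; have b0 : 0 < b := lt_le_trans a0 ab.
rewrite (@integration_by_substitution_decreasing R GRing.inv)//.
- apply: eq_integral => t; rewrite inE /= in_itv /= => /andP[ta _].
  by rewrite !fctE derive1_inv ?opprK// gt_eqF// (lt_le_trans a0).
- move=> x y; rewrite !in_itv /= => /andP[xa _] /andP[ya _] xy.
  by rewrite ltf_pV2// posrE (lt_le_trans a0).
- move=> x; rewrite in_itv /= => /andP[xa _].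
  by apply: continuous_derive1_inv; exact: lt_trans xa.
- apply/cvg_ex; eexists; apply: cvg_at_right_filter.
  exact: continuous_derive1_inv.
- apply/cvg_ex; eexists; apply: cvg_at_left_filter.
  exact: continuous_derive1_inv.
- split.
  + move=> x; rewrite in_itv /= => /andP[xa _].
    by apply: derivableV => //; rewrite gt_eqF// (lt_trans a0).
  + by apply: cvg_at_right_filter; apply: inv_continuous; rewrite gt_eqF.
  + by apply: cvg_at_left_filter; apply: inv_continuous; rewrite gt_eqF.
- apply: continuous_in_subspaceT => t; rewrite inE /= in_itv /= => /andP[tb _].
  by apply: cG; apply: lt_le_trans tb; rewrite invr_gt0.
Qed.

(** Indexed from 0, so that the interval of index n is [1/(n+1), n+1]. *)
Definition inv_itv (n : nat) : set R := `[n.+1%:R^-1, n.+1%:R].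

Lemma inv_itv_pos n t : inv_itv n t -> 0 < t.
Proof.
by rewrite /inv_itv /= in_itv /= => /andP[+ _]; apply: lt_le_trans; rewrite invr_gt0.
Qed.

Lemma bigcup_inv_itv : `]0, +oo[%classic = \bigcup_n inv_itv n.
Proof.
apply/seteqP; split=> [t|t [n _ /inv_itv_pos]]; rewrite /= in_itv /= andbT//.
move=> t0; exists (Num.bound (t + t^-1)) => //.
have tt : t + t^-1 < (Num.bound (t + t^-1)).+1%:R.
  apply: lt_le_trans (archi_boundP _) _; last by rewrite ler_nat.
  by rewrite ltW// addr_gt0// invr_gt0.
rewrite /inv_itv /= in_itv /= ; apply/andP; split; last first.
  by apply: le_trans (ltW tt); rewrite lerDl invr_ge0 ltW.
rewrite -[leRHS]invrK lef_pV2 ?posrE ?invr_gt0//.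
by apply: le_trans (ltW tt); rewrite lerDr ltW.
Qed.

Lemma nondecreasing_inv_itv : nondecreasing_seq inv_itv.
Proof.
move=> m n mn; apply/subsetPset => t; rewrite /inv_itv /= !in_itv /=.
move=> /andP[mt tm]; apply/andP; split.
  by apply: le_trans mt; rewrite lef_pV2 ?posrE// ler_nat.
by apply: le_trans tm _; rewrite ler_nat.
Qed.

Lemma measurable_fun_pos (F : R -> R) :
  (forall t, 0 < t -> {for t, continuous F}) -> measurable_fun (`]0, +oo[ : set R) F.
Proof.
move=> cF; apply: open_continuous_measurable_fun; first exact: interval_open.
by move=> t; rewrite inE /= in_itv /= andbT => /cF.
Qed.

(** The intervals [1/n, n] are invariant under inversion and exhaust the half-line,
    so the change of variables on compact intervals passes to the monotone
    limit. *)
Lemma integral_inv (G H : R -> R) :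
  (forall t, 0 < t -> {for t, continuous G}) ->
  (forall t, 0 < t -> 0 <= G t) ->
  (forall t, 0 < t -> H t = G t^-1 / t ^+ 2) ->
  (\int[mu]_(t in `]0%R, +oo[) (G t)%:E =
   \int[mu]_(t in `]0%R, +oo[) (H t)%:E)%E.
Proof.
move=> cG G0 HG.
have cH t : 0 < t -> {for t, continuous H}.
  move=> t0; rewrite /prop_for /continuous_at HG//.
  apply: (@cvg_trans _ ((G y^-1 / y ^+ 2) @[y --> t])).
    apply: near_eq_cvg; near=> y; rewrite HG//.
    by near: y; exact: lt_nbhsr.
  apply: (@continuousM _ _ (G \o GRing.inv) (fun y => y ^- 2)); last first.
    apply: continuousV; first by rewrite expf_neq0// gt_eqF.
    exact: exprn_continuous.
  apply: (@continuous_comp R R R (fun y => y^-1) G t).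
    by apply: inv_continuous; rewrite gt_eqF.
  by apply: cG; rewrite invr_gt0.
have H0 t : 0 < t -> 0 <= H t.
  by move=> t0; rewrite HG// divr_ge0// ?exprn_ge0 ?G0 ?invr_gt0// ltW.
have cvgI (F : R -> R) : (forall t, 0 < t -> {for t, continuous F}) ->
    (forall t, 0 < t -> 0 <= F t) ->
    ((\int[mu]_(t in inv_itv n) (F t)%:E)%E @[n --> \oo] -->
     (\int[mu]_(t in `]0%R, +oo[) (F t)%:E)%E).
  move=> cF F0; rewrite bigcup_inv_itv.
  apply: ge0_nondecreasing_set_cvg_integral.
  - exact: nondecreasing_inv_itv.
  - by move=> n; exact: measurable_itv.
  - move=> n; apply/measurable_EFinP.
    have mF : measurable_fun (inv_itv n) F.
      apply: (measurable_funS _ _ (measurable_fun_pos cF)) => //.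
      by move=> t /inv_itv_pos; rewrite /= in_itv /= andbT.
    exact: mF.
  - by move=> n t /inv_itv_pos t0; rewrite lee_fin F0.
apply/esym/(cvg_unique _ (cvgI _ cH H0)) => //.
apply: cvg_trans (cvgI _ cG G0); apply: near_eq_cvg; apply: nearW => n.
have := @integral_inv_itv G n.+1%:R^-1 n.+1%:R _ _ cG; rewrite invrK => -> //.
  by apply: eq_integral => t; rewrite inE => /inv_itv_pos /HG ->.
by rewrite (@le_trans _ _ 1)// ?invf_le1 ?ler1n.
Unshelve. all: by end_near. Qed.

End InversionSubstitution.

(** * Exchanging the spaces in the real method *)

Section RealMethod.
Variables (R : realType) (V : lmodType R[i]).
Implicit Types A B : nspace V.

(** Monotonicity of K(t) and of K(t) / t bounds |K(s) - K(t)| by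
    |s/t - 1| K(t). *)
Lemma continuous_Kfun A B x (t : R) : norm_ge0 A -> norm_ge0 B -> 0 < t ->
  {for t, continuous (fun s => Kfun A B s x)}.
Proof.
move=> A0 B0 t0; rewrite /prop_for /continuous_at.
pose K s := Kfun A B s x; rewrite -/(K t).
have KE s : 0 < s -> `|K s - K t| <= `|s / t - 1| * K t.
  move=> s0; have [st|/ltW ts] := leP s t.
    have q1 : s / t <= 1 by rewrite ler_pdivrMr// mul1r.
    have Kst : K s <= K t by apply: Kfun_homo => //; exact: ltW.
    have : K t <= t / s * K s by exact: Kfun_div_homo.
    rewrite -ler_pdivrMl ?divr_gt0// invf_div => qK.
    rewrite !ler0_norm ?subr_le0// !opprB mulrBl mul1r.
    by rewrite lerB.
  have q1 : 1 <= s / t by rewrite ler_pdivlMr// mul1r.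
  have Kts : K t <= K s by apply: Kfun_homo => //; exact: ltW.
  have qK : K s <= s / t * K t by exact: Kfun_div_homo.
  by rewrite !ger0_norm ?subr_ge0// mulrBl mul1r lerB.
have d0 : `|s / t - 1| * K t @[s --> t] --> 0.
  have : {for t, continuous (fun s : R => `|s / t - 1| * K t)}.
    apply: continuousM; last exact: cst_continuous.
    apply: (@continuous_comp R R R (fun s => s / t - 1) Num.norm); last first.
      exact: norm_continuous.
    apply: continuousB; last exact: cst_continuous.
    by apply: continuousM; [exact: cvg_id|exact: cst_continuous].
  by rewrite /prop_for /continuous_at divff ?gt_eqF// subrr normr0 mul0r.
apply: (@squeeze_cvgr _ _ _ _ (fun s => K t - `|s / t - 1| * K t)
                              (fun s => K t + `|s / t - 1| * K t)).
- near=> s; rewrite -ler_distl; apply: KE; near: s; exact: lt_nbhsr.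
- by rewrite -[X in _ --> X]subr0; apply: cvgB => //; exact: cvg_cst.
- by rewrite -[X in _ --> X]addr0; apply: cvgD => //; exact: cvg_cst.
Unshelve. all: by end_near. Qed.

(** By the same monotonicities K is either identically 0 or positive on the whole
    half-line. *)
Lemma Kfun_gt0 A B x (s t : R) : norm_ge0 A -> norm_ge0 B -> 0 < s -> 0 < t ->
  0 < Kfun A B t x -> 0 < Kfun A B s x.
Proof.
move=> A0 B0 s0 t0 Kt; have [st|/ltW ts] := leP s t.
  have := lt_le_trans Kt (Kfun_div_homo x A0 B0 s0 st).
  by rewrite pmulr_rgt0// divr_gt0.
by apply: lt_le_trans Kt _; apply: Kfun_homo => //; exact: ltW.
Qed.

Definition real_interp_integrand theta p A B x (t : R) : R :=
  (t `^ (- theta) * Kfun A B t x) `^ p / t.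

Lemma real_interp_integrand_ge0 theta p A B x t : 0 < t ->
  0 <= real_interp_integrand theta p A B x t.
Proof. by move=> t0; rewrite divr_ge0 ?powR_ge0 ?ltW. Qed.

Lemma continuous_powR (a t : R) : 0 < t -> {for t, continuous (@powR R ^~ a)}.
Proof.
move=> t0; apply: differentiable_continuous; apply/derivable1_diffP.
by apply: derivable_powR; rewrite in_itv /= andbT.
Qed.

(** The power function y -> y^p is smooth away from y = 0 only, and this is enough:
    if K vanishes at t, then the integrand vanishes identically. *)
Lemma continuous_real_interp_integrand theta p A B x (t : R) :
  p != 0 -> norm_ge0 A -> norm_ge0 B -> 0 < t ->
  {for t, continuous (real_interp_integrand theta p A B x)}.
Proof.
move=> p0 A0 B0 t0.
have [Kt|Kt] := ltP 0 (Kfun A B t x).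
  apply: continuousM; last first.
    by apply: inv_continuous; rewrite gt_eqF.
  apply: (@continuous_comp R R R (fun s => s `^ (- theta) * Kfun A B s x)
    (fun y => y `^ p)).
    by apply: continuousM; [exact: continuous_powR|exact: continuous_Kfun].
  by apply: continuous_powR; rewrite mulr_gt0// powR_gt0.
have Z s : 0 < s -> real_interp_integrand theta p A B x s = 0.
  move=> s0; rewrite /real_interp_integrand.
  suff -> : Kfun A B s x = 0 by rewrite mulr0 powR0// mul0r.
  apply/eqP; rewrite eq_le Kfun_ge0// ?andbT; last exact: ltW.
  rewrite leNgt; apply/negP => /(Kfun_gt0 A0 B0 t0 s0).
  by rewrite ltNge Kt.
rewrite /prop_for /continuous_at Z//.
apply: (@cvg_trans _ ((fun=> 0 : R) s @[s --> t])); last exact: (@cst_continuous R R 0 t).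
apply: near_eq_cvg; near=> s; rewrite Z//.
by near: s; exact: lt_nbhsr.
Unshelve. all: by end_near. Qed.

Lemma real_interp_normC theta p A B x : p != 0 -> norm_ge0 A -> norm_ge0 B ->
  real_interp_norm (1 - theta) p A B x = real_interp_norm theta p B A x.
Proof.
move=> p0 A0 B0; rewrite /real_interp_norm.
apply: (congr1 (fun z => (z `^ p^-1)%E)).
apply: (integral_inv (G := real_interp_integrand (1 - theta) p A B x)).
- by move=> t t0; exact: continuous_real_interp_integrand.
- by move=> t; exact: real_interp_integrand_ge0.
move=> t t0; rewrite /real_interp_integrand (Kfun_sym _ A0 B0 t0).
have tn0 : t != 0 by rewrite gt_eqF.
have -> : t^-1 `^ (- (1 - theta)) = t `^ (- theta) * t.
  rewrite -powR_inv1 ?ltW// -powRrM mulN1r opprK powRD ?tn0 ?implybT//.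
  by rewrite powRr1 ?ltW// mulrC.
rewrite mulrA -[in RHS]mulrA; congr (_ * _).
by rewrite invrK expr2 invfM mulVKf.
Qed.

(** The formula K(t; B, A) = t K(1/t; A, B) and the invariance of dt/t under
    inversion turn the exponent theta into 1 - theta. *)
Lemma real_interpC theta p A B : p != 0 -> norm_ge0 A -> norm_ge0 B ->
  real_interp (1 - theta) p A B = real_interp theta p B A.
Proof.
move=> p0 A0 B0; apply: nspace_eq => x /=; last by rewrite real_interp_normC.
rewrite real_interp_normC//; have := nsumC A B => /(congr1 (@carrier _ _)).
by move=> /(congr1 (fun E => E x)) /= ->.
Qed.

(** The integrands compare pointwise; continuity of K supplies their
    measurability. *)
Lemma real_interp_absorb theta p A B : 1 <= p ->
  norm_ge0 A -> norm_ge0 B -> lin_closed A -> lin_closed B -> nrm A 0 = 0 ->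
  carrier (real_interp theta p A B) `<=`
  carrier (real_interp theta p A (nsum A B)).
Proof.
move=> p1 A0 B0 lA lB nA0 x [xAB xfin].
have p0 : 0 < p := lt_le_trans ltr01 p1.
have S0 := nsum_norm_ge0 A0 B0.
split; first exact/nsum_absorb.
apply: le_lt_trans xfin; rewrite /real_interp_norm.
apply: (gt0_ler_poweR (r := p^-1)); first by rewrite invr_ge0 ltW.
1,2: by rewrite in_itv /= leey andbT; apply: integral_ge0 => t;
  rewrite /= in_itv /= andbT lee_fin; exact: real_interp_integrand_ge0.
have meas B' : norm_ge0 B' -> measurable_fun (`]0, +oo[ : set R)
    (EFin \o real_interp_integrand theta p A B' x).
  move=> B'0; apply/measurable_EFinP.
  apply: measurable_fun_pos => t t0.
  by apply: continuous_real_interp_integrand; rewrite ?gt_eqF.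
apply: ge0_le_integral => //; [|exact: meas|exact: meas|].
  by move=> t; rewrite /= in_itv /= andbT lee_fin; exact: real_interp_integrand_ge0.
move=> t; rewrite /= in_itv /= andbT lee_fin => t0.
rewrite ler_pM2r ?invr_gt0// ge0_ler_powR ?nnegrE ?(ltW p0)//.
- by rewrite mulr_ge0 ?powR_ge0 ?Kfun_ge0// ltW.
- by rewrite mulr_ge0 ?powR_ge0 ?Kfun_ge0// ltW.
- by rewrite ler_wpM2l ?powR_ge0// Kfun_absorb// ltW.
Qed.

End RealMethod.

(** * Couples whose spaces are exchanged by an involution *)

Section SymmetricCouple.
Variables (R : realType) (V : lmodType R[i]) (T : {linear V -> V}).
Variables (A B : nspace V) (theta p : R).

(** In each of the four isomorphisms the target is the transport of the source. *)
Lemma symmetric_couple : involutive T -> B = pullback T A -> 1 <= p ->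
  norm_ge0 A -> lin_closed A -> symmetric_norm A -> nrm A 0 = 0 ->
  [/\ isomorphism (real_interp theta p A (nsum A B))
                  (real_interp theta p B (nsum A B)) T,
      carrier (real_interp theta p A B) `<=`
        carrier (real_interp theta p A (nsum A B)),
      isomorphism (real_interp theta p A B) (real_interp (1 - theta) p A B) T &
  [/\ isomorphism (complex_interp theta A (nsum A B))
                  (complex_interp theta B (nsum A B)) T,
      carrier (complex_interp theta A B) `<=`
        carrier (complex_interp theta A (nsum A B))
    & isomorphism (complex_interp theta A B)
                  (complex_interp (1 - theta) A B) T]].
Proof.
move=> TT BE p1 A0 lA sA nA0.
have B0 : norm_ge0 B by rewrite BE; exact: pullback_norm_ge0.
have lB : lin_closed B by rewrite BE; exact: pullback_lin_closed.
have AE : A = pullback T B by rewrite BE pullbackK.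
have sB : symmetric_norm B.
  rewrite /symmetric_norm BE -[in RHS]sA.
  by apply: nspace_eq => x; rewrite /= linearN.
have p0 : p != 0 by rewrite gt_eqF// (lt_le_trans ltr01).
have SE : nsum A B = pullback T (nsum A B).
  by rewrite -(nsum_pullback TT) -AE -BE nsumC.
have realE : real_interp theta p B (nsum A B) =
    pullback T (real_interp theta p A (nsum A B)).
  by rewrite -(real_interp_pullback TT) -BE -SE.
have realE' : real_interp (1 - theta) p A B = pullback T (real_interp theta p A B).
  by rewrite -(real_interp_pullback TT) -BE -AE; exact: real_interpC p0 A0 B0.
have complexE : complex_interp theta B (nsum A B) =
    pullback T (complex_interp theta A (nsum A B)).
  by rewrite -(complex_interp_pullback TT) -BE -SE.
have complexE' : complex_interp (1 - theta) A B =
    pullback T (complex_interp theta A B).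
  rewrite -(complex_interp_pullback TT) -BE -AE.
  exact: complex_interp_reflect sA sB.
rewrite realE realE' complexE complexE'.
split; [exact: isomorphism_pullback|exact: real_interp_absorb|
  exact: isomorphism_pullback|].
split; [exact: isomorphism_pullback|exact: complex_interp_absorb|
  exact: isomorphism_pullback].
Qed.

End SymmetricCouple.

(** * The sequence spaces *)

Section SequenceSpaces.
Variable R : realType.
Implicit Types (x y u : cseq R) (k : R[i]).
Notation c0 := (c0 R).
Notation ell1 := (ell1 R).

Lemma cabs_ge0 k : 0 <= cabs k.
Proof. by case: k => a b; exact: sqrtr_ge0. Qed.

Lemma le_cabs_linear k x y n :
  cabs ((k *: x + y) n) <= cabs k * cabs (x n) + cabs (y n).
Proof. by rewrite -Normc.normcM; exact: le_normcD. Qed.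

Lemma c0_lin_closed : lin_closed c0.
Proof.
split=> [|k x y cx cy].
  rewrite /= [X in X @ _](_ : _ = fun=> 0); first exact: cvg_cst.
  by apply/funext => n; exact: Normc.normc0.
apply: (@squeeze_cvgr _ _ _ _ (cst 0)
  (fun n => cabs k * cabs (x n) + cabs (y n))); last 2 first.
- exact: cvg_cst.
- rewrite -[X in _ --> X](addr0 0) -[X in _ --> X + _](mulr0 (cabs k)).
  by apply: cvgD => //; apply: cvgM => //; exact: cvg_cst.
by apply: nearW => n; rewrite cabs_ge0 le_cabs_linear.
Qed.

Lemma c0Z k x : c0 x -> c0 (k *: x).
Proof.
move=> cx; rewrite -[_ *: _]addr0.
by case: c0_lin_closed => c00 lc0; exact: lc0.
Qed.

Lemma c0_has_ubound x : c0 x -> has_ubound (range (fun n => cabs (x n))).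
Proof.
move=> /cvgP /cvg_seq_bounded [M [_ /(_ (M + 1))]].
rewrite ltrDl ltr01 => /(_ isT) bM; exists (M + 1) => _ [n _ <-].
by have := bM n I; rewrite /= ger0_norm// cabs_ge0.
Qed.

Lemma cabs_le_c0 x n : c0 x -> cabs (x n) <= nrm c0 x.
Proof. by move=> /c0_has_ubound ub; apply: ub_le_sup => //; exists n. Qed.

Lemma c0_norm_ge0 : norm_ge0 c0.
Proof.
move=> x; rewrite /=; have [ub|nub] := pselect (has_sup (range (fun n => cabs (x n)))).
  by apply: le_trans (cabs_ge0 (x 0%N)) _; apply: ub_le_sup; [case: ub|exists 0%N].
by rewrite sup_out.
Qed.

Lemma le_nrm_c0_linear k x y : c0 x -> c0 y ->
  nrm c0 (k *: x + y) <= cabs k * nrm c0 x + nrm c0 y.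
Proof.
move=> cx cy; apply: ge_sup; first by exists (cabs ((k *: x + y) 0%N)), 0%N.
move=> _ [n _ <-]; apply: le_trans (le_cabs_linear _ _ _ _) _.
by apply: lerD; [rewrite ler_wpM2l ?cabs_ge0//|]; exact: cabs_le_c0.
Qed.

Lemma finite_support_c0 x N : (forall n, (N <= n)%N -> x n = 0) -> c0 x.
Proof.
move=> xN; rewrite /=; apply: (@cvg_trans _ ((fun=> 0 : R) n @[n --> \oo])).
  apply: near_eq_cvg; exists N => // n /= Nn.
  by rewrite xN// Normc.normc0.
exact: cvg_cst.
Qed.

Lemma c0_sum (u : nat -> cseq R) N :
  (forall n, c0 (u n)) -> c0 (\sum_(n < N) u n).
Proof.
move=> cu; elim: N => [|N IH].
  by rewrite big_ord0; case: c0_lin_closed.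
by rewrite big_ord_recr; exact: (lin_closedD c0_lin_closed).
Qed.

(** The terms have to be in c_0: the norm of c_0 is a supremum, which satisfies the
    triangle inequality on bounded sequences only (an unbounded one gets the
    default value 0). *)
Lemma has_series_sum_linear k (u v : nat -> cseq R) x y :
  (forall n, c0 (u n)) -> (forall n, c0 (v n)) ->
  has_series_sum c0 u x -> has_series_sum c0 v y ->
  has_series_sum c0 (fun n => k *: u n + v n) (k *: x + y).
Proof.
move=> cu cv [cx ux] [cy vy]; split; first by case: c0_lin_closed => _; apply.
have lin N : \sum_(n < N) (k *: u n + v n) - (k *: x + y) =
    k *: (\sum_(n < N) u n - x) + (\sum_(n < N) v n - y).
  by rewrite big_split -scaler_sumr opprD addrACA -scalerBr.
apply: (@squeeze_cvgr _ _ _ _ (cst 0)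
  (fun N => cabs k * nrm c0 (\sum_(n < N) u n - x) +
            nrm c0 (\sum_(n < N) v n - y))); last 2 first.
- exact: cvg_cst.
- rewrite -[X in _ --> X](addr0 0) -[X in _ --> X + _](mulr0 (cabs k)).
  by apply: cvgD => //; apply: cvgM => //; exact: cvg_cst.
apply: nearW => N; rewrite c0_norm_ge0 lin le_nrm_c0_linear//;
  exact: (lin_closedB c0_lin_closed (c0_sum _ _)).
Qed.

Lemma c0_e_ n : c0 (e_ R n).
Proof.
apply: (@finite_support_c0 _ n.+1) => m nm.
by rewrite /e_ gtn_eqF.
Qed.

Lemma sum_e_ (a : nat -> R[i]) N n :
  (n < N)%N -> (\sum_(m < N) a m *: e_ R m) n = a n.
Proof.
move=> nN.
have -> : (\sum_(m < N) a m *: e_ R m) n = \sum_(m < N) a m * (n == m)%:R.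
  by elim/big_rec2: _ => // m y1 y2 _ <-.
rewrite (bigD1 (Ordinal nN))//= eqxx mulr1 big1 ?addr0// => m.
by rewrite -val_eqE /= eq_sym => /negbTE ->; rewrite mulr0.
Qed.

(** Convergence in c_0 implies convergence of each coordinate, and coordinate n of
    the partial sums is a_n from rank n + 1 on. *)
Lemma has_series_sum_e_0 (a : nat -> R[i]) n :
  has_series_sum c0 (fun n => a n *: e_ R n) 0 -> a n = 0.
Proof.
move=> [_ a0]; apply: Normc.eq0_normc; apply/eqP.
rewrite eq_le cabs_ge0 andbT.
have cS N : c0 (\sum_(m < N) a m *: e_ R m).
  by apply: (c0_sum (u := fun m => a m *: e_ R m)) => m; exact: c0Z (c0_e_ m).
apply: (cvgr_to_ge a0); exists n.+1 => // N nN.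
change (cabs (a n) <= nrm c0 (\sum_(m < N) a m *: e_ R m - 0)).
by rewrite subr0 -(sum_e_ a nN); exact: cabs_le_c0.
Qed.

Lemma has_series_sum0 : has_series_sum c0 (fun=> 0) 0.
Proof.
have c00 : c0 0 by case: c0_lin_closed.
split=> //; rewrite /ncvg [X in X @ _](_ : _ = fun=> 0); first exact: cvg_cst.
apply/funext => N; rewrite big1// subrr; apply/eqP.
rewrite eq_le c0_norm_ge0 andbT; apply: ge_sup; first by exists (cabs (0 : R[i])), 0%N.
by move=> _ [n _ <-]; rewrite [X in X <= _]Normc.normc0.
Qed.

Lemma series_cabs0 : series (fun n => cabs ((0 : cseq R) n)) = fun=> 0.
Proof.
by apply/funext => N; rewrite /series /= big1// => n _; exact: Normc.normc0.
Qed.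

Lemma ell1_lin_closed : lin_closed ell1.
Proof.
split=> [|k x y cx cy].
  by rewrite /= series_cabs0; exact: is_cvg_cst.
apply: (@series_le_cvg _ _ (fun n => cabs k * cabs (x n) + cabs (y n))).
- by move=> n; exact: cabs_ge0.
- by move=> n; rewrite addr_ge0 ?mulr_ge0 ?cabs_ge0.
- by move=> n; exact: le_cabs_linear.
exact: (is_cvg_seriesD (is_cvg_seriesZ cx) cy).
Qed.

Lemma ell1_norm_ge0 : norm_ge0 ell1.
Proof.
move=> a /=; have [ca|/dvgP ->//] := pselect (cvgn (series (fun n => cabs (a n)))).
apply: limr_ge => //; apply: nearW => n.
by apply: sumr_ge0 => i _; exact: cabs_ge0.
Qed.

Lemma nrm_ell1N a : nrm ell1 (- a) = nrm ell1 a.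
Proof.
rewrite /=; congr (limn (series _)); apply/funext => n; exact: normcN.
Qed.

Lemma nrm_ell10 : nrm ell1 0 = 0.
Proof.
by rewrite /= series_cabs0 lim_cst.
Qed.

End SequenceSpaces.

(** * The symmetry of the Garling-Smith couple *)

Section GarlingSmithCouple.
Variables (R : realType) (r : nat -> cseq R).
Hypothesis hr : is_enumeration r.
Notation c0 := (c0 R).
Notation ell1 := (ell1 R).
Implicit Types (a b c : nat -> R[i]) (x y : gsV R).

Definition swap (x : gsV R) : gsV R := (x.1.1, x.2, x.1.2).

Lemma swap_linear : linear swap.
Proof. by move=> k [[x1 x2] x3] [[y1 y2] y3]. Qed.

HB.instance Definition _ :=
  GRing.isLinear.Build R[i] (gsV R) (gsV R) _ swap swap_linear.

Lemma swapK : involutive swap.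
Proof. by move=> [[]]. Qed.

Lemma GS1_coefs_swap a b c x : GS1_coefs r a b c x <-> GS0_coefs r a c b (swap x).
Proof. by split=> -[[? ? ?] [? ? ?]]. Qed.

(** Exchanging the coefficients b and c exchanges the formulas that define the two
    spaces, up to the order of the last two coordinates. *)
Lemma GS1E : GS1 r = pullback swap (GS0 r).
Proof.
apply: nspace_eq => x /=.
  by split=> -[a [b [c /GS1_coefs_swap abc]]]; exists a, c, b.
congr get; apply/seteqP; split=> s [a [b [c [abc ->]]]]; exists a, c, b.
  by rewrite -GS1_coefs_swap addrAC.
by rewrite GS1_coefs_swap addrAC.
Qed.

Lemma c0_r n : c0 (r n).
Proof.
have [N _ [_ rN]] : finite_sign_seq (r n) by case: hr => + _ _; apply.
exact: finite_support_c0 rN.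
Qed.

Lemma GS0_coefs_linear k a b c a' b' c' x y :
  GS0_coefs r a b c x -> GS0_coefs r a' b' c' y ->
  GS0_coefs r (k *: (a : cseq R) + a') (k *: (b : cseq R) + b')
    (k *: (c : cseq R) + c') (k *: x + y).
Proof.
move=> [[la lb lc] [x1 x2 x3]] [[la' lb' lc'] [y1 y2 y3]].
have [_ ll] := ell1_lin_closed R.
have ce d n : c0 (d *: e_ R n) := c0Z d (c0_e_ n).
have cr d n : c0 (d *: r n) := c0Z d (c0_r n).
have sumE (u v w : nat -> cseq R) z t : (forall n, c0 (u n)) ->
    (forall n, c0 (v n)) -> (forall n, k *: u n + v n = w n) ->
    has_series_sum c0 u z -> has_series_sum c0 v t ->
    has_series_sum c0 w (k *: z + t).
  by move=> cu cv /funext <-; exact: has_series_sum_linear.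
split; first by split; exact: ll.
split.
- apply: sumE x1 y1 => n; try exact: (lin_closedD (c0_lin_closed R)).
  by rewrite scalerDr !scalerA addrACA -!scalerDl.
- apply: sumE x2 y2 => // n.
  by rewrite scalerA -scalerDl mulrCA -mulrDr.
- by apply: sumE x3 y3 => // n; rewrite scalerA -scalerDl.
Qed.

Lemma GS0_coefs00 : GS0_coefs r 0 0 0 0.
Proof.
have [l0 _] := ell1_lin_closed R.
have sum0 (u : nat -> cseq R) : u = (fun=> 0) -> has_series_sum c0 u 0.
  move=> ->; exact: has_series_sum0.
split=> //; split; apply: sum0; apply/funext => n.
- by rewrite !scale0r addr0.
- by rewrite mulr0 scale0r.
- by rewrite scale0r.
Qed.

Lemma GS0_lin_closed : lin_closed (GS0 r).
Proof.
split=> [|k x y [a [b [c xabc]]] [a' [b' [c' yabc]]]].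
  by exists 0, 0, 0; exact: GS0_coefs00.
by do 3!eexists; exact: GS0_coefs_linear xabc yabc.
Qed.

Lemma eps_gt0 n : 0 < eps_ r n.
Proof.
by rewrite /eps_ invr_gt0 exprn_gt0// ltr_wpDr// ell1_norm_ge0.
Qed.

(** The second coordinate gives b = 0 because every epsilon_n is nonzero, the third
    gives c = 0, and then the first reduces to the series of the a_n e_n. *)
Lemma GS0_coefs0 a b c : GS0_coefs r a b c 0 -> [/\ a = 0, b = 0 & c = 0].
Proof.
move=> [_ [a0 b0 c0]].
have bE : b = 0.
  apply/funext => n; have /eqP := has_series_sum_e_0 n b0.
  rewrite mulf_eq0 => /orP[|/eqP//].
  by rewrite eq_complex /= gt_eqF// eps_gt0.
split=> //; apply/funext => n; last exact: has_series_sum_e_0 c0.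
apply: (@has_series_sum_e_0 _ _ n).
move: a0; rewrite bE.
by under [X in has_series_sum _ X _]eq_fun => m do rewrite scale0r addr0.
Qed.

(** Either coefficients exist, and the norm is that of some choice of them, or the
    norm is the default value 0. *)
Lemma nrm_GS0P x : nrm (GS0 r) x = 0 \/
  exists a b c, GS0_coefs r a b c x /\
    nrm (GS0 r) x = nrm ell1 a + nrm ell1 b + nrm ell1 c.
Proof.
pose S := [set s | exists a b c, GS0_coefs r a b c x /\
  s = nrm ell1 a + nrm ell1 b + nrm ell1 c].
have [Sx|nS] := pselect (exists s, S s); first by right; exact: (getPex Sx).
by left; apply: (@getPN _ S) => s Ss; apply: nS; exists s.
Qed.

Lemma GS0_norm_ge0 : norm_ge0 (GS0 r).
Proof.
move=> x; have [->//|[a [b [c [_ ->]]]]] := nrm_GS0P x.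
by rewrite !addr_ge0// ell1_norm_ge0.
Qed.

Lemma nrm_GS00 : nrm (GS0 r) 0 = 0.
Proof.
have [->//|[a [b [c [/GS0_coefs0[-> -> ->] ->]]]]] := nrm_GS0P 0.
by rewrite !nrm_ell10 !addr0.
Qed.

Lemma symmetric_GS0 : symmetric_norm (GS0 r).
Proof.
have coefsN a b c x : GS0_coefs r a b c x ->
    GS0_coefs r (- (a : cseq R)) (- (b : cseq R)) (- (c : cseq R)) (- x).
  move=> abc; have := GS0_coefs_linear (-1) abc GS0_coefs00.
  by rewrite !addr0 !scaleN1r.
apply: nspace_eq => x /=.
  split=> -[a [b [c /coefsN abc]]]; do 3!eexists; last exact: abc.
  by move: abc; rewrite opprK => abc; exact: abc.
congr get; apply/seteqP; split=> s [a [b [c [/coefsN abc ->]]]];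
  rewrite ?opprK in abc; do 3!eexists; split; try exact: abc;
  by congr (_ + _ + _); exact/esym/nrm_ell1N.
Qed.

End GarlingSmithCouple.

Theorem mainTheorem2 (R : realType) (r : nat -> cseq R)
  (hr : is_enumeration r) (theta p : R)
  (htheta : 0 < theta < 1) (hp : 1 <= p) :
  (exists U : gsV R -> gsV R,
    [/\ isomorphism
          (real_interp theta p (GS0 r) (nsum (GS0 r) (GS1 r)))
          (real_interp theta p (GS1 r) (nsum (GS0 r) (GS1 r))) U,
        carrier (real_interp theta p (GS0 r) (GS1 r)) `<=`
          carrier (real_interp theta p (GS0 r) (nsum (GS0 r) (GS1 r)))
      & isomorphism
          (real_interp theta p (GS0 r) (GS1 r))
          (real_interp (1 - theta) p (GS0 r) (GS1 r)) U]) /\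
  (exists U : gsV R -> gsV R,
    [/\ isomorphism
          (complex_interp theta (GS0 r) (nsum (GS0 r) (GS1 r)))
          (complex_interp theta (GS1 r) (nsum (GS0 r) (GS1 r))) U,
        carrier (complex_interp theta (GS0 r) (GS1 r)) `<=`
          carrier (complex_interp theta (GS0 r) (nsum (GS0 r) (GS1 r)))
      & isomorphism
          (complex_interp theta (GS0 r) (GS1 r))
          (complex_interp (1 - theta) (GS0 r) (GS1 r)) U]).
Proof.
have [||||rU rI rU' [cU cI cU']] := symmetric_couple theta (@swapK R) (GS1E r) hp.
- exact: GS0_norm_ge0.
- exact: GS0_lin_closed.
- exact: symmetric_GS0.
- exact: nrm_GS00.
split; exists (@swap R); split.
- exact: rU.
- exact: rI.
- exact: rU'.
- exact: cU.
- exact: cI.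
- exact: cU'.
Qed.
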